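(* Let $\Gamma$ be a gain operator on $\ell^\infty_+(\mathcal I)$ such that (i) $\Gamma$ satisfies the $\oplus$-MBI property, and (ii) for every $r\ge0$, the maximal fixed point $\sigma^*(r)$ of $\Gamma^\oplus_{r\mathbf 1}(s):=r\mathbf 1\oplus\Gamma(s)$ is semi-attractive from above, i.e. $\|(\Gamma^\oplus_{r\mathbf 1})^n(s)-\sigma^*(r)\|\to0$ for every $s\ge\sigma^*(r)$. Then there exists a $C^0$-path of decay for $\Gamma$.
   Context: Let $\mathcal I$ be a nonempty countable index set; $\ell^\infty_+(\mathcal I)$ is the cone of nonnegative real families $s=(s_i)_{i\in\mathcal I}$ with $\|s\|:=\sup_i|s_i|<\infty$, ordered componentwise; $\mathbf 1$ is the all-ones vector; $\oplus$ is the componentwise maximum. $\mathcal K_\infty$: continuous strictly increasing unbounded $\gamma:\mathbb R_+\to\mathbb R_+$ with $\gamma(0)=0$. For $\mathcal J\subset\mathcal I$, $s_{|\mathcal J}$ agrees with $s$ on $\mathcal J$ and is $0$ elsewhere. Gain operator: for each $i$ a finite (possibly empty) $\mathcal I_i\subset\mathcal I\setminus\{i\}$; directed graph $\mathcal G$ with vertices $\mathcal I$ and edges $ji$, $j\in\mathcal I_i$; a pointwise equicontinuous family $\gamma_{ij}\in\mathcal K_\infty$ ($ji\in E(\mathcal G)$); functions $\mu_i:\ell^\infty_+(\mathcal I)\to[0,\infty]$ with (M1) some $\xi\in\mathcal K_\infty$ has $\mu_i(0)=0$, $\mu_i(s)\ge\xi(\|s\|)$; (M2) $\mu_i$ monotone;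 (M3) for each finite $\mathcal J$, $\mu_i$ restricted to vectors vanishing off $\mathcal J$ is finite-valued and continuous; (M4) for each norm-bounded $A$ and $\varepsilon>0$ there is $\delta>0$ with $\sup_i|\mu_i(s_{|\mathcal I_i})-\mu_i(s^0_{|\mathcal I_i})|\le\varepsilon$ whenever $s^0\in A$, $\|s-s^0\|\le\delta$. $\Gamma_i(s):=\mu_i([\gamma_{ij}(s_j)]_{j\in\mathcal I_i})$ (argument zero outside $\mathcal I_i$). $\oplus$-MBI property: there is $\varphi\in\mathcal K_\infty$ such that for all $s,b$, $s\le b\oplus\Gamma(s)$ implies $\|s\|\le\varphi(\|b\|)$; under this property each operator $s\mapsto b\oplus\Gamma(s)$ has a maximal fixed point (one dominating every fixed point). $\Psi(\Gamma):=\{s:\Gamma(s)\le s\}$. A $C^0$-path of decay for $\Gamma$ is a path $\sigma:\mathbb R_+\to\ell^\infty_+(\mathcal I)$ with $\sigma(r)\in\Psi(\Gamma)$ for all $r$, $\varphi_{\min}(r)\mathbf 1\le\sigma(r)\le\varphi_{\max}(r)\mathbf 1$ for some $\varphi_{\min},\varphi_{\max}\in\mathcal K_\infty$, increasing and norm-continuous. *)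

(* Defs.v *)
From HB Require Import structures.
From mathcomp Require Import all_boot all_order all_algebra.
From mathcomp Require Import all_classical all_reals all_analysis.
Set Implicit Arguments. Unset Strict Implicit. Unset Printing Implicit Defensive.
Import Order.TTheory GRing.Theory Num.Theory.
Import numFieldNormedType.Exports.
Local Open Scope classical_set_scope.
Local Open Scope ring_scope.

Section Defs.
Context {R : realType} {I : countType}.

Definition linfp (s : I -> R) : Prop :=
  (forall i, 0 <= s i) /\ exists M : R, forall i, `|s i| <= M.

(* sup-norm ||s|| = sup_i |s_i| (meaningful for bounded s) *)
Definition nrm (s : I -> R) : R := sup [set `|s i| | i in [set: I]].

Definition dist (s t : I -> R) : R := nrm (fun i => s i - t i).

Definition leI (s t : I -> R) : Prop := forall i, s i <= t i.

Definition omax (b s : I -> R) : I -> R := fun i => Num.max (b i) (s i).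

Definition restr (J : seq I) (s : I -> R) : I -> R :=
  fun i => if i \in J then s i else 0.

Definition Kinf (g : R -> R) : Prop :=
  [/\ g 0 = 0,
      {within [set x : R | 0 <= x], continuous g},
      (forall x y, 0 <= x -> x < y -> g x < g y)
    & (forall M, exists x, 0 <= x /\ M <= g x)].

(* Gamma_i(s) := mu_i([gamma_ij(s_j)]_{j in I_i}) (argument zero outside I_i).
   By (M3) this value is finite, so [fine] is harmless. *)
Definition Gam (Ii : I -> seq I) (gam : I -> I -> R -> R)
    (mu : I -> (I -> R) -> \bar R) (s : I -> R) : I -> R :=
  fun i => fine (mu i (fun j => if j \in Ii i then gam i j (s j) else 0)).

Record is_gain_op (Ii : I -> seq I) (gam : I -> I -> R -> R)
    (mu : I -> (I -> R) -> \bar R) : Prop := {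
  go_noloop : forall i, i \notin Ii i;
  go_Kinf : forall i j, j \in Ii i -> Kinf (gam i j);
  go_equicont : forall r, 0 <= r -> forall e, 0 < e ->
    exists2 d, 0 < d & forall i j r', j \in Ii i -> 0 <= r' -> `|r - r'| <= d ->
      `|gam i j r - gam i j r'| <= e;
  go_M1 : exists2 xi, Kinf xi &
    forall i, mu i (cst 0) = 0%E /\
      forall s, linfp s -> ((xi (nrm s))%:E <= mu i s)%E;
  go_M2 : forall i s t, linfp s -> linfp t -> leI s t -> (mu i s <= mu i t)%E;
  go_M3_fin : forall i (J : seq I) s, linfp s -> (forall j, j \notin J -> s j = 0) ->
    mu i s \is a fin_num;
  go_M3_cont : forall i (J : seq I) s, linfp s -> (forall j, j \notin J -> s j = 0) ->
    forall e, 0 < e -> exists2 d, 0 < d &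
      forall t, linfp t -> (forall j, j \notin J -> t j = 0) -> dist t s <= d ->
        `|fine (mu i t) - fine (mu i s)| <= e;
  go_M4 : forall A : set (I -> R), A `<=` linfp ->
    (exists M : R, forall s, A s -> nrm s <= M) ->
    forall e, 0 < e -> exists2 d, 0 < d &
      forall s s0, A s0 -> linfp s -> dist s s0 <= d ->
        forall i, (`| mu i (restr (Ii i) s) - mu i (restr (Ii i) s0) | <= e%:E)%E
}.

Definition MBI (G : (I -> R) -> (I -> R)) : Prop :=
  exists2 phi, Kinf phi &
    forall s b, linfp s -> linfp b -> leI s (omax b (G s)) -> nrm s <= phi (nrm b).

Definition maxfix (T : (I -> R) -> (I -> R)) (sig : I -> R) : Prop :=
  [/\ linfp sig, T sig = sig & forall s, linfp s -> T s = s -> leI s sig].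

Definition semi_attr_above (T : (I -> R) -> (I -> R)) (sig : I -> R) : Prop :=
  forall s, linfp s -> leI sig s ->
    (fun n : nat => dist (iter n T s) sig) @ \oo --> (0 : R).

Definition C0_path_of_decay (G : (I -> R) -> (I -> R)) (sig : R -> I -> R) : Prop :=
  [/\ (forall r, 0 <= r -> linfp (sig r) /\ leI (G (sig r)) (sig r)),
      (exists phimin phimax, [/\ Kinf phimin, Kinf phimax &
          forall r, 0 <= r -> leI (cst (phimin r)) (sig r) /\ leI (sig r) (cst (phimax r))]),
      (forall r1 r2, 0 <= r1 -> r1 <= r2 -> leI (sig r1) (sig r2))
    & (forall r, 0 <= r -> forall e, 0 < e -> exists2 d, 0 < d &
          forall r', 0 <= r' -> `|r - r'| < d -> dist (sig r') (sig r) < e)].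

End Defs.

(* Main.v *)
(** Let [T_r s = r1 (+) Gamma s], with maximal fixed point [sigma* r]; these are
    increasing in [r] and satisfy [r1 <= sigma* r <= phi(r)1], but [sigma*] may jump.
    For [r <= r'] the iterates [T_r^n (sigma* r')] decrease to [sigma* r] in norm by
    semi-attractivity. Since [Gamma] maps each iterate below the next one, the whole
    segment between consecutive iterates consists of decay points, so piecewise
    linear interpolation joins [sigma* r'] to [sigma* r] by a continuous increasing
    path of decay points. Gluing these paths along [r = e^k], [k] an integer, gives a
    path with [r/e <= sigma r <= phi(e r)]. *)

Require Import Defs.
From HB Require Import structures.
From mathcomp Require Import all_boot all_order all_algebra.
From mathcomp Require Import all_classical all_reals all_analysis.
From mathcomp Require Import ring lra.
Import Order.TTheory GRing.Theory Num.Theory.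
Import numFieldNormedType.Exports.
Local Open Scope classical_set_scope.
Local Open Scope ring_scope.

(** * Monotone norm-continuous paths: gluing and reparametrization *)

(* For a monotone [f] the second clause is norm-continuity at [x]. *)
Definition monotone_path {R : realType} {I : Type} (f : R -> I -> R) :=
  (forall x y, x <= y -> forall i, f x i <= f y i) /\
  (forall x e, 0 < e -> exists2 d, 0 < d &
     forall i, f (x + d) i <= f (x - d) i + e).

(** Monotonicity lets both one-sided radii shrink to their minimum, and the two errors [e / 2] add
    up. The sides are separated because at a knot they lie in different cells of a glued path. *)
Lemma monotone_path_one_sided {R : realType} {I : Type} (f : R -> I -> R) :
  (forall x y, x <= y -> forall i, f x i <= f y i) ->
  (forall x e, 0 < e -> exists2 d, 0 < d & forall i, f (x + d) i <= f x i + e) ->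
  (forall x e, 0 < e -> exists2 d, 0 < d & forall i, f x i <= f (x - d) i + e) ->
  monotone_path f.
Proof.
move=> fm fr fl; split=> // x e e0.
have e20 : 0 < e / 2 by rewrite divr_gt0.
have [d d0 hd] := fr x _ e20; have [d' d'0 hd'] := fl x _ e20.
exists (Num.min d d') => [|i]; first by rewrite lt_min d0.
have h1 : f (x + Num.min d d') i <= f (x + d) i.
  by apply: fm; rewrite lerD2l ge_min lexx.
have h2 : f (x - d') i <= f (x - Num.min d d') i.
  by apply: fm; rewrite lerD2l lerN2 ge_min lexx orbT.
by move: (hd i) (hd' i); lra.
Qed.

(** The cell [[k, k + 1]] carries a copy of [p k]. Right continuity at [x] is read off in the cell
    starting at [floor x], left continuity in the cell ending at [ceil x], so knots need no separate
    case. *)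
Lemma glue_paths {R : realType} {I : Type} (p : int -> R -> I -> R) :
  (forall k, monotone_path (p k)) -> (forall k, p k 1 = p (k + 1) 0) ->
  exists P : R -> I -> R, monotone_path P /\
    forall k t, 0 <= t <= 1 -> P (k%:~R + t) = p k t.
Proof.
move=> pm p10.
pose P x := p (Num.floor x) (x - (Num.floor x)%:~R).
have cell k t : 0 <= t <= 1 -> P (k%:~R + t) = p k t.
  (* [floor] assigns the endpoint [t = 1] to the next cell, where [p10] gives the same value. *)
  move=> /andP[t0]; rewrite le_eqVlt => /orP[/eqP ->|t1]; rewrite /P.
    by rewrite -[1]/(1%:~R) -intrD intrKfloor subrr -p10.
  rewrite (@floor_def _ _ k) ?rmorphD /=; last by apply/andP; split; lra.
  by rewrite addrAC subrr add0r.
exists P; split => //.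
have knots k n i : p k 0 i <= p (k + n%:Z) 0 i.
  elim: n => [|n IH]; first by rewrite addr0.
  rewrite -addn1 PoszD addrA (le_trans IH)// -p10.
  by apply: (pm _).1.
apply: monotone_path_one_sided.
- move=> x y xy i.
  have /andP[fx0 fx1] := floor_itv x; have /andP[fy0 fy1] := floor_itv y.
  rewrite rmorphD /= in fx1; rewrite rmorphD /= in fy1.
  have := le_floor xy; rewrite le_eqVlt => /orP[/eqP fE|flt].
    rewrite /P -fE; apply: (pm _).1; lra.
  have [n nE] : exists n : nat, Num.floor y = Num.floor x + 1 + n%:Z.
    exists (absz (Num.floor y - (Num.floor x + 1))%R).
    rewrite gez0_abs ?subr_ge0 ?lezD1//.
    by rewrite addrC subrK.
  apply: (@le_trans _ _ (p (Num.floor x) 1 i)).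
    by apply: (pm _).1; lra.
  rewrite p10 (le_trans (knots _ n i))// -nE.
  by apply: (pm _).1; lra.
- move=> x e e0.
  have /andP[fx0 fx1] := floor_itv x; rewrite rmorphD /= in fx1.
  set k := Num.floor x in fx0 fx1; pose t := x - k%:~R.
  have [d d0 hd] := (pm k).2 t _ e0.
  have t01 : 0 <= t < 1 by rewrite /t; lra.
  have xE : x = k%:~R + t by rewrite /t; lra.
  exists (Num.min d (1 - t)) => [|i]; first by rewrite lt_min d0; lra.
  have d'0 : 0 <= Num.min d (1 - t) by rewrite le_min; lra.
  have d'd : Num.min d (1 - t) <= d by rewrite ge_min lexx.
  have d'1 : Num.min d (1 - t) <= 1 - t by rewrite ge_min lexx orbT.
  rewrite xE -addrA !cell; [|lra|lra].
  have h1 := (pm k).1 (t + Num.min d (1 - t)) (t + d) ltac:(lra) i.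
  have h2 := (pm k).1 (t - d) t ltac:(lra) i.
  by move: (hd i); lra.
- move=> x e e0.
  have /andP[fx0 fx1] := ceil_itv x; rewrite rmorphB /= in fx0.
  (* With [ceil x - 1] instead of the floor, [t] lies in []0, 1]]: a knot is the right end of its
     cell, leaving room on the left. *)
  set k := Num.ceil x - 1; pose t := x - k%:~R.
  have kE : k%:~R = (Num.ceil x)%:~R - 1 :> R by rewrite rmorphB.
  have [d d0 hd] := (pm k).2 t _ e0.
  have t01 : 0 < t <= 1 by rewrite /t; lra.
  have xE : x = k%:~R + t by rewrite /t; lra.
  exists (Num.min d t) => [|i]; first by rewrite lt_min d0; lra.
  have d'0 : 0 <= Num.min d t by rewrite le_min; lra.
  have d'd : Num.min d t <= d by rewrite ge_min lexx.
  have d't : Num.min d t <= t by rewrite ge_min lexx orbT.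
  rewrite xE -addrA !cell; [|lra|lra].
  have h1 := (pm k).1 t (t + d) ltac:(lra) i.
  have h2 := (pm k).1 (t - d) (t - Num.min d t) ltac:(lra) i.
  by move: (hd i); lra.
Qed.

(* The logarithm turns a path with a limit at [-oo] into one starting at [0]. *)
Lemma extend_path {R : realType} {I : Type} (Q : R -> I -> R) (a : I -> R) :
  monotone_path Q -> (forall x i, a i <= Q x i) ->
  (forall e, 0 < e -> exists x, forall i, Q x i <= a i + e) ->
  monotone_path (fun t => if t <= 0 then a else Q (ln t)).
Proof.
move=> Qm aQ Qa; have mono : forall x y, x <= y -> forall i,
    (if x <= 0 then a else Q (ln x)) i <= (if y <= 0 then a else Q (ln y)) i.
  move=> x y xy i; case: ifPn => x0; case: ifPn => y0 //.
    by exfalso; lra.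
  by apply: Qm.1; rewrite ler_ln ?posrE; lra.
split => // x e e0; have [x0|x0] := leP x 0.
  (* Up to [expR y] the path stays below [Q y], and to the left of 0 it equals [a]. *)
  have [y hy] := Qa _ e0; exists (expR y) => [|i]; first exact: expR_gt0.
  have y0 := expR_gt0 y.
  rewrite [in leRHS]ifT; last by lra.
  apply: le_trans (hy i).
  have -> : Q y = if expR y <= 0 then a else Q (ln (expR y)).
    by rewrite expRK ifF//; apply/negbTE; rewrite -ltNge.
  by apply: mono; lra.
have [d d0 hd] := Qm.2 (ln x) _ e0.
have E1 : expR (- d) < 1 by rewrite -expR0 ltr_expR; lra.
have E0 := expR_gt0 (- d).
have E2 : 1 < expR d by rewrite -expR0 ltr_expR.
have EE : expR d * expR (- d) = 1 by rewrite expRN divff// gt_eqF// expR_gt0.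
(* The left end is then exactly [x * expR (- d)]; the right end is at most [x * expR d], because
   [expR d + expR (- d) >= 2]. *)
exists (x * (1 - expR (- d))) => [|i]; first by rewrite mulr_gt0//; lra.
have xd0 : 0 < x * expR (- d) by rewrite mulr_gt0.
have xd1 : 0 < x * expR d by rewrite mulr_gt0//; lra.
have -> : x - x * (1 - expR (- d)) = x * expR (- d) by ring.
apply: (@le_trans _ _ (Q (ln x + d) i)).
  have -> : Q (ln x + d) = if x * expR d <= 0 then a else Q (ln (x * expR d)).
    by rewrite ifF ?lnM ?posrE ?expR_gt0// ?expRK//; apply/negbTE; rewrite -ltNge.
  apply: mono; have h : 0 <= x * ((expR d - 1) * (1 - expR (- d))).
    by rewrite !mulr_ge0//; lra.
  have h2 : x * (expR d * expR (- d)) = x by rewrite EE mulr1.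
  by lra.
rewrite ifF; last by apply/negbTE; rewrite -ltNge.
by rewrite lnM ?posrE ?expR_gt0// expRK.
Qed.

(** The bound [M] on the increments is uniform in [i], which makes the segment Lipschitz in norm. *)
Lemma linear_path {R : realType} {I : Type} (a b : I -> R) (M : R) :
  (forall i, a i <= b i <= a i + M) ->
  monotone_path (fun t i => a i + t * (b i - a i)).
Proof.
move=> abM; split=> [x y xy i|x e e0].
  by have := abM i; nra.
pose N := `|M| + 1.
have N0 : 0 < N by rewrite ltr_wpDl.
have MN : M <= N by have := ler_norm M; rewrite /N; lra.
exists (e / (2 * N)) => [|i]; first by rewrite divr_gt0 ?mulr_gt0.
have dN : e / (2 * N) * N *+ 2 = e.
  by rewrite invfM mulrA -(mulrA _ N^-1) mulVf ?gt_eqF// mulr1 -mulr_natr mulfVK.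
have d0 : 0 < e / (2 * N) by rewrite divr_gt0 ?mulr_gt0.
have := abM i; move: (e / (2 * N)) d0 dN => d d0 dN.
by nra.
Qed.

(** * The sup norm on bounded nonnegative families *)

Section Operator.
Context {R : realType} {I : countType} (i0 : I).
Implicit Types (s : I -> R).

Lemma nrm_ub s i : linfp s -> s i <= nrm s.
Proof.
move=> [_ [M hM]]; apply: le_trans (ler_norm _) _.
apply: ub_le_sup; last by exists i.
by exists M => _ [j _ <-].
Qed.

Lemma nrm_le s M : (forall i, `|s i| <= M) -> nrm s <= M.
Proof.
move=> hM; apply: ge_sup; first by exists `|s i0|; exists i0.
by move=> _ [j _ <-].
Qed.

Lemma linfp_sandwich s (t : I -> R) : (forall i, 0 <= s i) -> leI s t -> linfp t -> linfp s.
Proof.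
move=> s0 st [t0 [M hM]]; split=> //; exists M => i.
by apply: le_trans (hM i); rewrite !ger0_norm.
Qed.

Lemma linfp_cst (r : R) : 0 <= r -> linfp (cst r : I -> R).
Proof. by move=> r0; split=> //; exists r => i; rewrite ger0_norm. Qed.

Lemma nrm_cst (r : R) : 0 <= r -> nrm (cst r : I -> R) = r.
Proof.
move=> r0; apply/eqP; rewrite eq_le nrm_le => [/=|i]; last by rewrite ger0_norm.
by apply: (@nrm_ub (cst r) i0); exact: linfp_cst.
Qed.

(** * Maximal fixed points and local decay paths of a monotone operator *)

Context (G : (I -> R) -> I -> R).
Hypothesis G_mono : forall s (t : I -> R), linfp s -> linfp t -> leI s t -> leI (G s) (G t).

(* Tarski's supremum of all sub-fixed points; since [G] need not map bounded
   vectors to bounded ones here, [r (+) G sig] is truncated at a height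
   exceeding the a priori bound before it is compared with the supremum. *)
Lemma maximal_fixpoint (phi : R -> R) (r : R) : 0 <= r ->
  (forall s, linfp s -> leI s (omax (cst r) (G s)) -> nrm s <= phi r) ->
  exists2 sig, maxfix (fun s => omax (cst r) (G s)) sig &
    forall s, linfp s -> leI s (omax (cst r) (G s)) -> leI s sig.
Proof.
move=> r0 mbi; pose S := [set s | linfp s /\ leI s (omax (cst r) (G s))].
have S0 : S (cst 0).
  split; first exact: linfp_cst.
  by move=> i; rewrite /omax /= le_max r0.
have Sphi s i : S s -> s i <= phi r.
  by case=> ls sT; apply: le_trans (nrm_ub _ i ls) (mbi _ ls sT).
pose sig i := sup [set s i | s in S].
have Ssig s : S s -> leI s sig.
  move=> Ss i; apply: ub_le_sup; last by exists s.
  by exists (phi r) => _ [t St <-]; exact: Sphi.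
have sig_le u : (forall s, S s -> leI s u) -> leI sig u.
  move=> hu i; apply: ge_sup; first by exists 0, (cst 0).
  by move=> _ [t St <-]; exact: hu.
have sig_phi i : sig i <= phi r.
  by apply: (sig_le (cst (phi r))) => s Ss j; exact: Sphi.
have phi0 : 0 <= phi r := Sphi _ i0 S0.
have sig0 i : 0 <= sig i by exact: (Ssig _ S0).
have lsig : linfp sig by apply: (linfp_sandwich _ (cst (phi r))) => //; exact: linfp_cst.
pose T s := omax (cst r) (G s).
have T_mono s (t : I -> R) : linfp s -> linfp t -> leI s t -> leI (T s) (T t).
  move=> ls lt st i; rewrite /T /omax /= ge_max le_max lexx /= le_max.
  by rewrite (G_mono _ _ ls lt st) orbT.
have sigT : leI sig (T sig).
  apply: sig_le => s Ss i.
  exact: le_trans (Ss.2 i) (T_mono _ _ Ss.1 lsig (Ssig _ Ss) i).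
pose t i := Num.min (T sig i) (phi r + 1).
have sigt : leI sig t.
  by move=> i; rewrite le_min sigT /= ler_wpDr.
have lt : linfp t.
  apply: (@linfp_sandwich _ (cst (phi r + 1))) => [i|i|].
  - exact: le_trans (sig0 i) (sigt i).
  - by rewrite ge_min lexx orbT.
  - by apply: linfp_cst; rewrite addr_ge0.
(* Since [sig] lies below [t], [t <= T sig <= T t], so [t] itself belongs to [S]. *)
have tsig : leI t sig.
  apply: Ssig; split=> // i; apply: le_trans (T_mono _ _ lsig lt sigt i).
  by rewrite ge_min lexx.
exists sig => [|s ls sT]; last exact: Ssig.
split=> // [|s ls sT]; last by apply: Ssig; split=> // i; rewrite -[in leLHS]sT.
apply/funext => i; apply/eqP; rewrite eq_le sigT andbT.
(* The cap [phi r + 1] cannot be the minimum, as [sig i <= phi r]; hence [T sig i <= sig i]. *)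
have := tsig i; rewrite ge_min => /orP[//|h].
by have := sig_phi i; lra.
Qed.

(* The segment between [c k] and [c (k + 1)] consists of decay points, because
   [G] maps it below [c k]. *)
Lemma chain_path (c : int -> I -> R) (a : I -> R) :
  linfp a -> leI (G a) a -> (forall k, leI a (c k)) -> (forall k, linfp (c k)) ->
  (forall k, leI (c k) (c (k + 1))) -> (forall k, leI (G (c (k + 1))) (c k)) ->
  (forall e, 0 < e -> exists k, forall i, c k i <= a i + e) ->
  exists p : R -> I -> R, [/\ monotone_path p, p 0 = a, p 1 = c 0 &
    forall t, linfp (p t) /\ leI (G (p t)) (p t)].
Proof.
move=> la Ga ac lc cm Gc ca.
pose p k t i := c k i + t * (c (k + 1) i - c k i).
have pm k : monotone_path (p k).
  apply: (@linear_path _ _ _ _ (nrm (c (k + 1)))) => i.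
  by have := cm k i; have := nrm_ub _ i (lc (k + 1)); have := (lc k).1 i; lra.
have p0 k : p k 0 = c k by apply/funext => i; rewrite /p mul0r addr0.
have p1 k : p k 1 = c (k + 1) by apply/funext => i; rewrite /p mul1r addrC subrK.
have [Q [Qm Qp]] := glue_paths _ pm (fun k => etrans (p1 k) (esym (p0 _))).
have Qc k : Q k%:~R = c k by rewrite -[k%:~R]addr0 Qp ?p0// lexx ler01.
have Qcell x : exists k, leI (c k) (Q x) /\ leI (Q x) (c (k + 1)).
  exists (Num.floor x); have /andP[fx0 fx1] := floor_itv x.
  by rewrite -!Qc; split=> i; apply: Qm.1 => //; exact: ltW.
have Qpsi x : linfp (Q x) /\ leI (G (Q x)) (Q x).
  have [k [h1 h2]] := Qcell x.
  have lQ : linfp (Q x).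
    by apply: (linfp_sandwich _ _ _ h2 (lc _)) => i; exact: le_trans ((lc k).1 i) (h1 i).
  split=> // i; apply: le_trans (h1 i); apply: le_trans (Gc k i).
  exact: G_mono.
(* The logarithm sends []0, 1]] to []-oo, 0]]: the knots of negative index accumulate at parameter
   0, and [t = 1] hits the knot [c 0]. *)
exists (fun t => if t <= 0 then a else Q (ln t)); split.
- apply: extend_path => // [x i|e e0].
    by have [k [h _]] := Qcell x; exact: le_trans (ac k i) (h i).
  by have [k hk] := ca _ e0; exists k%:~R; rewrite Qc.
- by rewrite lexx.
- by rewrite ifF ?ln1 ?(Qc 0)//; apply/negbTE; rewrite -ltNge.
- by move=> t; case: ifP.
Qed.

(** [T b <= b] and monotonicity make the iterates of [b] decrease while staying above the fixed
    point [a]; semi-attractivity makes them converge to it. Listed backwards, they form a chain for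
    [chain_path]. *)
Lemma iterates_path (a b : I -> R) (r : R) :
  let T := fun s => omax (cst r) (G s) in
  linfp a -> linfp b -> leI a b -> T a = a -> leI (T b) b ->
  semi_attr_above T a ->
  exists p : R -> I -> R, [/\ monotone_path p, p 0 = a, p 1 = b &
    forall t, linfp (p t) /\ leI (G (p t)) (p t)].
Proof.
move=> T la lb ab Ta Tb att.
have GT s : leI (G s) (T s) by move=> i; rewrite le_max lexx orbT.
have T_mono s (t : I -> R) : linfp s -> linfp t -> leI s t -> leI (T s) (T t).
  move=> ls lt st i; rewrite /T /omax /= ge_max le_max lexx /= le_max.
  by rewrite (G_mono _ _ ls lt st) orbT.
pose s n := iter n T b.
have [ls as_ sS] : [/\ forall n, linfp (s n), forall n, leI a (s n) &
    forall n, leI (s n.+1) (s n)].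
  suff h n : [/\ linfp (s n), leI a (s n) & leI (s n.+1) (s n)].
    by split=> n; case: (h n).
  elim: n => [|n [ln an sn]]; first by [].
  have aS : leI a (s n.+1).
    by move=> i; rewrite -[in leLHS]Ta; exact: T_mono.
  have lS : linfp (s n.+1).
    by apply: (linfp_sandwich _ _ _ sn ln) => i; exact: le_trans (la.1 i) (aS i).
  by split=> //; exact: T_mono.
have NegzS n : Negz n.+1 + 1 = Negz n.
  by rewrite !NegzE -(addn1 n.+1) PoszD opprD addrNK.
(* As [Negz n] is [-(n + 1)], index [-m] carries [s m]; the chain is constant from index 0 on. *)
pose c k := if k is Negz n then s n.+1 else b.
apply: (@chain_path c a) => //.
- by move=> i; rewrite -[in leRHS]Ta; exact: GT.
- by case=> n; [exact: ab|exact: (as_ n.+1)].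
- by case=> n; [exact: lb|exact: (ls n.+1)].
- case=> [n|[|n]] i; [exact: lexx|exact: (sS 0%N)|].
  by rewrite NegzS; exact: (sS n.+1).
- case=> [n|[|n]] i; [exact: le_trans (GT _ _) (Tb i)|exact: (GT b)|].
  by rewrite NegzS; exact: (GT (s n.+1)).
(* The element [c (Negz n)] is [s n.+1], which lies below the close iterate [s n]. *)
- move=> e e0; have /cvgr0_norm_lt/(_ _ e0) := att _ lb ab.
  move=> [n _ /(_ n (leqnn n))] /= h; exists (Negz n) => i /=.
  have h1 : s n i - a i <= dist (s n) a.
    apply: (@nrm_ub (fun i => s n i - a i)).
    apply: (linfp_sandwich _ (s n)) => // j.
      by rewrite subr_ge0; exact: as_.
    by rewrite gerBl; exact: la.1.
  have h2 : dist (s n) a < e := le_lt_trans (ler_norm _) h.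
  by apply: le_trans (sS n i) _; lra.
Qed.

(** * Comparison functions *)

Lemma Kinf_le (phi : R -> R) (x y : R) : Kinf phi -> 0 <= x -> x <= y -> phi x <= phi y.
Proof.
move=> [_ _ inc _] x0; rewrite le_eqVlt => /orP[/eqP ->//|xy].
exact/ltW/inc.
Qed.

Lemma Kinf_scale (phi : R -> R) (c : R) : 0 < c -> Kinf phi -> Kinf (fun x => phi (c * x)).
Proof.
move=> c0 [phi0 cphi inc unb]; split.
- by rewrite mulr0.
- apply/subspace_continuousP => x x0; apply/cvgrPdist_lt => e e0.
  have cx0 : 0 <= c * x by rewrite mulr_ge0// ltW.
  move/subspace_continuousP: cphi => /(_ _ cx0) /cvgrPdist_lt /(_ _ e0).
  move=> /nbhs_ballP[d /= d0 hd]; apply/nbhs_ballP; exists (d / c) => /=.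
    by rewrite divr_gt0.
  move=> y; rewrite /ball /= => xy y0; apply: hd => /=.
    suff : `|c * x - c * y| < d by [].
    by rewrite -mulrBr normrM gtr0_norm// mulrC -ltr_pdivlMr.
  by rewrite mulr_ge0// ltW.
- by move=> x y x0 xy; apply: inc; rewrite ?mulr_ge0 ?ltr_pM2l// ltW.
- move=> M; have [x [x0 hx]] := unb M; exists (x / c); split.
    by rewrite divr_ge0// ltW.
  by rewrite mulrC mulfVK// gt_eqF.
Qed.

Lemma Kinf_id : Kinf (@id R).
Proof.
split=> //; first by apply: continuous_subspaceT => x; exact: cvg_id.
by move=> M; exists `|M|; rewrite normr_ge0 ler_norm.
Qed.

Lemma Kinf_small (phi : R -> R) (e : R) : Kinf phi -> 0 < e ->
  exists2 x, 0 < x & phi x <= e.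
Proof.
move=> [phi0 cphi _ _] e0.
move/subspace_continuousP: cphi => /(_ 0 (lexx _)) /cvgrPdist_lt /(_ _ e0).
move=> /nbhs_ballP[d /= d0 hd]; exists (d / 2); first by rewrite divr_gt0.
have d20 : 0 < d / 2 by rewrite divr_gt0.
have : `|phi 0 - phi (d / 2)| < e.
  apply: hd; last exact: ltW.
  suff : `|0 - d / 2| < d by [].
  by rewrite sub0r normrN gtr0_norm//; lra.
rewrite phi0 sub0r normrN => h.
exact/ltW/(le_lt_trans (ler_norm _) h).
Qed.

(** * Assembly of the path on the logarithmic scale *)

Lemma path_of_decay : MBI G -> leI (G (cst 0)) (cst 0) ->
  (forall r : R, 0 <= r -> forall sig : I -> R,
     maxfix (fun s => omax (cst r) (G s)) sig ->
     semi_attr_above (fun s => omax (cst r) (G s)) sig) ->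
  exists sig : R -> I -> R, C0_path_of_decay G sig.
Proof.
move=> [phi Kphi mbi] G0 att.
(* Domination of all sub-fixed points is kept for monotonicity in [r]: a fixed point for [r] is
   sub-fixed for every [r' >= r]. For [r <= 0] the value is a dummy. *)
have [st stP] : {st : R -> I -> R & forall r, 0 < r ->
    maxfix (fun s => omax (cst r) (G s)) (st r) /\
    forall s, linfp s -> leI s (omax (cst r) (G s)) -> leI s (st r)}.
  apply: (@choice _ _ (fun r sig => 0 < r ->
    maxfix (fun s => omax (cst r) (G s)) sig /\
    forall s, linfp s -> leI s (omax (cst r) (G s)) -> leI s sig)) => r.
  have [r0|r0] := ltP 0 r; last by exists (cst 0) => r1; exfalso; lra.
  have [s ls sT|sig] := @maximal_fixpoint phi r (ltW r0).
    by rewrite -[in leRHS](nrm_cst _ (ltW r0)); apply: mbi => //; apply/linfp_cst/ltW.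
  by move=> sigP sig_top; exists sig.
have lst r : 0 < r -> linfp (st r) by move=> /stP[[]].
have Tst r : 0 < r -> omax (cst r) (G (st r)) = st r by move=> /stP[[]].
have r_st r i : 0 < r -> r <= st r i by move=> r0; rewrite -Tst// le_max lexx.
have st_phi r i : 0 < r -> st r i <= phi r.
  move=> r0; apply: le_trans (nrm_ub _ i (lst _ r0)) _.
  rewrite -[in leRHS](nrm_cst _ (ltW r0)); apply: mbi.
  - exact: lst.
  - exact/linfp_cst/ltW.
  - by rewrite Tst// => j.
have omax_le (r r' : R) s : r <= r' -> leI (omax (cst r) (G s)) (omax (cst r') (G s)).
  by move=> rr' i; rewrite /omax /= ge_max !le_max rr' lexx orbT.
have st_mono r r' : 0 < r -> r <= r' -> leI (st r) (st r').
  move=> r0 rr'; apply: (stP r' (lt_le_trans r0 rr')).2; first exact: lst.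
  by rewrite -[X in leI X _]Tst//; exact: omax_le.
(* [ln] turns these radii into the integer knots of [glue_paths]. *)
pose E (k : int) : R := expR k%:~R.
have E0 k : 0 < E k by exact: expR_gt0.
have ES k : E (k + 1) = expR 1 * E k by rewrite /E rmorphD expRD mulrC.
have [p pP] : {p : int -> R -> I -> R & forall k,
    [/\ monotone_path (p k), p k 0 = st (E k), p k 1 = st (E (k + 1)) &
        forall t, linfp (p k t) /\ leI (G (p k t)) (p k t)]}.
  apply: (@choice _ _ (fun k (pk : R -> I -> R) =>
    [/\ monotone_path pk, pk 0 = st (E k), pk 1 = st (E (k + 1)) &
        forall t, linfp (pk t) /\ leI (G (pk t)) (pk t)])) => k.
  have EE : E k <= E (k + 1) by rewrite ler_expR ler_int lerDl.
  apply: (@iterates_path _ _ (E k)).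
  - exact: lst.
  - exact: lst.
  - exact: st_mono.
  - exact: Tst.
  (* Lowering the level from [E (k + 1)] to [E k] shrinks the operator, so it maps the upper fixed
     point below itself. *)
  - by rewrite -[X in leI _ X]Tst//; exact: omax_le.
  - by apply: att; [exact: ltW|exact: (stP _ _).1].
have p0 k : p k 0 = st (E k) by case: (pP k).
have p1 k : p k 1 = st (E (k + 1)) by case: (pP k).
have pm k : monotone_path (p k) by case: (pP k).
have [P [Pm Pp]] := glue_paths _ pm (fun k => etrans (p1 k) (esym (p0 _))).
(* A cell spans a factor [expR 1] in the radius, and each bound loses this factor once. *)
have Pfloor x : [/\ leI (cst (expR x / expR 1)) (P x), leI (P x) (cst (phi (expR 1 * expR x))) &
    linfp (P x) /\ leI (G (P x)) (P x)].
  have /andP[fx0 fx1] := floor_itv x; rewrite rmorphD /= in fx1.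
  set k := Num.floor x in fx0 fx1.
  have xE : x = k%:~R + (x - k%:~R) by lra.
  have Px : P x = p k (x - k%:~R) by rewrite {1}xE Pp//; lra.
  rewrite Px; split; last by case: (pP k).
  - move=> i; apply: (@le_trans _ _ (p k 0 i)); last by apply: (pm k).1; lra.
    rewrite p0; apply: le_trans (r_st _ i (E0 k)).
    by rewrite /= -expRN -expRD ler_expR; lra.
  - move=> i; apply: (@le_trans _ _ (p k 1 i)); first by apply: (pm k).1; lra.
    rewrite p1; apply: le_trans (st_phi _ i (E0 _)) _.
    apply: Kinf_le => //; first exact: ltW.
    by rewrite ES ler_pM2l ?expR_gt0// ler_expR.
have K1 : Kinf (fun x => phi (expR 1 * x)) by apply: Kinf_scale => //; exact: expR_gt0.
pose sigma (t : R) := if t <= 0 then cst 0 else P (ln t).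
have [sm sc] : monotone_path sigma.
  apply: extend_path => // [x i|e e0].
    by have [_ _ [[]]] := Pfloor x.
  (* The upper bound [phi (expR 1 * expR x)] is small near [-oo], so the path tends to zero
     there. *)
  have [x x0 hx] := Kinf_small _ _ K1 e0; exists (ln x) => i.
  have [_ h _] := Pfloor (ln x); apply: le_trans (h i) _.
  by rewrite add0r lnK.
exists sigma; split.
- move=> r r0; rewrite /sigma; case: ifP => _; first by split=> //; exact: linfp_cst.
  by case: (Pfloor (ln r)).
- exists (fun x => (expR 1)^-1 * x), (fun x => phi (expR 1 * x)); split=> //.
    have e0 : 0 < (expR 1 : R)^-1 by rewrite invr_gt0 expR_gt0.
    exact: (Kinf_scale _ _ e0 Kinf_id).
  move=> r; rewrite /sigma le_eqVlt => /orP[/eqP <-|r0].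
    rewrite lexx !mulr0; have [-> _ _ _] := Kphi.
    by split=> i; exact: lexx.
  rewrite ifF; last by apply/negbTE; rewrite -ltNge.
  have [h1 h2 _] := Pfloor (ln r); split.
    by move=> i; have := h1 i; rewrite lnK//= mulrC.
  by move=> i; have := h2 i; rewrite lnK.
- by move=> r1 r2 _ r12; exact: sm.
- move=> r r0 e e0; have e20 : 0 < e / 2 by rewrite divr_gt0.
  (* Both [sigma r] and [sigma r'] lie between [sigma (r - d)] and [sigma (r + d)], at most [e / 2]
     apart; halving keeps the inequality strict after the supremum. *)
  have [d d0 hd] := sc r _ e20; exists d => // r' r'0; rewrite ltr_norml => rr'.
  apply: (@le_lt_trans _ _ (e / 2)); last by lra.
  apply: nrm_le => i; have := hd i.
  have := sm (r - d) r ltac:(lra) i; have := sm r (r + d) ltac:(lra) i.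
  have := sm (r - d) r' ltac:(lra) i; have := sm r' (r + d) ltac:(lra) i.
  by rewrite ler_norml; lra.
Qed.

End Operator.

(** * Gain operators *)

(** [fine] respects the order between finite values, and (M3) makes both values finite because the
    arguments of [mu i] vanish off the finite list [Ii i]; (M2) then compares them. *)
Lemma Gam_mono {R : realType} {I : countType} (Ii : I -> seq I)
    (gam : I -> I -> R -> R) (mu : I -> (I -> R) -> \bar R) :
  is_gain_op Ii gam mu ->
  forall s t, linfp s -> linfp t -> leI s t -> leI (Gam Ii gam mu s) (Gam Ii gam mu t).
Proof.
move=> go s t ls lt st i.
pose v u j := if j \in Ii i then gam i j (u j) else 0.
have lv u : linfp u -> linfp (v u).
  move=> lu; have v0 j : 0 <= v u j.
    rewrite /v; case: ifPn => // jI; have [<- _ _ _] := go_Kinf go jI.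
    by apply: Kinf_le (go_Kinf go jI) _ _; last exact: lu.1.
  split=> //; exists (\sum_(j <- Ii i) v u j) => j; rewrite ger0_norm//.
  have [jI|jI] := boolP (j \in Ii i).
    by rewrite (big_rem j)//= lerDl sumr_ge0.
  by rewrite {1}/v (negbTE jI) sumr_ge0.
have vJ u j : j \notin Ii i -> v u j = 0 by rewrite /v => /negbTE ->.
apply: fine_le.
- exact: (go_M3_fin go i (lv _ ls) (vJ s)).
- exact: (go_M3_fin go i (lv _ lt) (vJ t)).
apply: (go_M2 go i (lv _ ls) (lv _ lt)) => j; rewrite /v; case: ifPn => // jI.
by apply: Kinf_le (go_Kinf go jI) _ (st j); exact: ls.1.
Qed.

Lemma Gam0 {R : realType} {I : countType} (Ii : I -> seq I)
    (gam : I -> I -> R -> R) (mu : I -> (I -> R) -> \bar R) :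
  is_gain_op Ii gam mu -> Gam Ii gam mu (cst 0) = cst 0.
Proof.
move=> go; apply/funext => i; rewrite /Gam /=.
rewrite (_ : (fun j => _) = cst 0); last first.
  by apply/funext => j; case: ifPn => // jI; have [-> _ _ _] := go_Kinf go jI.
by have [xi _ /(_ i)[-> _]] := go_M1 go.
Qed.

Theorem theorem3p24 (R : realType) (I : countType) (i0 : I)
    (Ii : I -> seq I) (gam : I -> I -> R -> R) (mu : I -> (I -> R) -> \bar R) :
  is_gain_op Ii gam mu ->
  MBI (Gam Ii gam mu) ->
  (forall r : R, 0 <= r -> forall sig : I -> R,
     maxfix (fun s => omax (cst r) (Gam Ii gam mu s)) sig ->
     semi_attr_above (fun s => omax (cst r) (Gam Ii gam mu s)) sig) ->
  exists sig : R -> I -> R, C0_path_of_decay (Gam Ii gam mu) sig.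
Proof.
move=> go mbi att; apply: (path_of_decay i0 _ (Gam_mono _ _ _ go) mbi) => //.
by rewrite Gam0.
Qed.
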